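(* Let $G$ be a digraph without double edges and $n\ge0$ an integer. Then for maps $f\colon\Delta^n\to G$, the non-degenerate singular simplicial maps coincide with the singular simplicial homomorphisms and with the singular simplicial inclusions. In particular, $$H_n^{\Delta,i}(G)\cong H_n^{\Delta,h}(G)\cong H_n^{\Delta,m}(G).$$
   Context: A digraph $G$ consists of a non-empty set $V_G$ and a set $E_G\subseteq\{(u,v)\in V_G\times V_G\mid u\ne v\}$ of edges; $(u,v)$ is also written $u\to v$ and has source $u$ and target $v$. $G$ has a double edge if for some $u\ne v$ both $(u,v)$ and $(v,u)$ are edges. A (quiver) map $m\colon G\to G'$ of digraphs is a pair $m_V\colon V_G\to V_{G'}$, $m_E\colon E_G\to E_{G'}\sqcup V_{G'}$ such that each edge $e$ is sent either to an edge with source $m_V(s(e))$ and target $m_V(t(e))$, or to the vertex $m_V(s(e))=m_V(t(e))$. A homomorphism is a map sending edges to edges; an inclusion is a homomorphism with $m_V$ and $m_E$ injective. $R$ is a fixed commutative ring. $\Delta^n$ is the digraph with vertices $0,\dots,n$ and edges $(a,b)$ for all $a<b$; for $0\le i\le n$, $\delta_i\colon\Delta^{n-1}\to\Delta^n$ is the unique homomorphism with $\delta_i(j)=j$ for $j<i$ and $j+1$ otherwise. $C_n^{\Delta,m}(G)$, $C_n^{\Delta,h}(G)$, $C_n^{\Delta,i}(G)$ are the free $R$-modules on maps (singular simplicial maps), homomorphisms, and inclusions $f\colon\Delta^n\to G$, respectively, with differential $\partial_n(f)=\sum_{i=0}^n(-1)^if\circ\delta_i$; $H_*^{\Delta,m}$,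 $H_*^{\Delta,h}$, $H_*^{\Delta,i}$ are their homologies. A singular simplicial map $f\colon\Delta^n\to G$ is degenerate if $f(i-1)=f(i)=f(i-1\to i)$ for some $i=1,\dots,n$ (i.e. the edge $i-1\to i$ is sent to a vertex), and non-degenerate otherwise. *)

(* Defs.v *)
From HB Require Import structures.
From mathcomp Require Import all_boot all_algebra generic_quotient ring_quotient zify.
From mathcomp Require Import finmap boolp classical_sets.
From mathcomp.multinomials Require Import monalg.

Set Implicit Arguments.
Unset Strict Implicit.
Unset Printing Implicit Defensive.

Import GRing.Theory.

Local Open Scope classical_set_scope.
Local Open Scope ring_scope.

Record digraph := Digraph {
  vertex :> Type;
  edges : set (vertex * vertex);
  vertex_inhabited : inhabited vertex;
  edges_irrefl : forall u v, edges (u, v) -> u <> v }.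

Definition edge (G : digraph) : Type := set_type (@edges G).

Definition source (G : digraph) (e : edge G) : G := (val e).1.
Definition target (G : digraph) (e : edge G) : G := (val e).2.

Definition has_double_edge (G : digraph) : Prop :=
  exists u v : G, [/\ u <> v, edges (u, v) & edges (v, u)].

Record qmap (G G' : digraph) := QMap {
  mapV : G -> G';
  mapE : edge G -> edge G' + G';
  mapE_compat : forall e : edge G,
    match mapE e with
    | inl e' => source e' = mapV (source e) /\ target e' = mapV (target e)
    | inr v => v = mapV (source e) /\ v = mapV (target e)
    end }.

HB.instance Definition _ (G G' : digraph) := gen_eqMixin (qmap G G').
HB.instance Definition _ (G G' : digraph) := gen_choiceMixin (qmap G G').

Lemma qmapP (G G' : digraph) (f g : qmap G G') :
  mapV f =1 mapV g -> mapE f =1 mapE g -> f = g.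
Proof.
case: f g => [fV fE fP] [gV gE gP] /= /funext eqV /funext eqE.
by subst gV gE; congr QMap.
Qed.

Definition homomorphism (G G' : digraph) : set (qmap G G') :=
  [set m | forall e, exists e', mapE m e = inl e'].

Definition inclusion (G G' : digraph) : set (qmap G G') :=
  [set m | [/\ homomorphism m, injective (mapV m) & injective (mapE m)]].

Section Composition.
Variables (G1 G2 G3 : digraph) (g : qmap G2 G3) (f : qmap G1 G2).

Definition comp_mapE (e : edge G1) : edge G3 + G3 :=
  match mapE f e with inl e' => mapE g e' | inr v => inr (mapV g v) end.

Fact comp_mapE_compat (e : edge G1) :
  match comp_mapE e with
  | inl e' => source e' = mapV g (mapV f (source e)) /\
              target e' = mapV g (mapV f (target e))
  | inr v => v = mapV g (mapV f (source e)) /\ v = mapV g (mapV f (target e))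
  end.
Proof.
rewrite /comp_mapE; have := mapE_compat f e.
case: (mapE f e) => [e'|v] [<- <-] //; exact: mapE_compat.
Qed.

Definition qmap_comp : qmap G1 G3 :=
  @QMap G1 G3 (mapV g \o mapV f) comp_mapE comp_mapE_compat.

End Composition.

Lemma qmap_compA (G1 G2 G3 G4 : digraph)
    (h : qmap G3 G4) (g : qmap G2 G3) (f : qmap G1 G2) :
  qmap_comp (qmap_comp h g) f = qmap_comp h (qmap_comp g f).
Proof.
apply: qmapP => // e; rewrite /= /comp_mapE /= /comp_mapE.
by case: (mapE f e).
Qed.

Lemma homomorphism_comp (G1 G2 G3 : digraph) (g : qmap G2 G3) (f : qmap G1 G2) :
  homomorphism g -> homomorphism f -> homomorphism (qmap_comp g f).
Proof.
move=> hg hf e; rewrite /= /comp_mapE; have [e' ->] := hf e; exact: hg.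
Qed.

Lemma inclusion_comp (G1 G2 G3 : digraph) (g : qmap G2 G3) (f : qmap G1 G2) :
  inclusion g -> inclusion f -> inclusion (qmap_comp g f).
Proof.
move=> [hg gV gE] [hf fV fE]; split; first exact: homomorphism_comp.
  exact: inj_comp.
move=> e1 e2; rewrite /= /comp_mapE.
have [e1' h1] := hf e1; have [e2' h2] := hf e2.
rewrite h1 h2 => /gE h12; apply: fE; by rewrite h1 h2 h12.
Qed.

Section HomOfVertexMap.
Variables (G G' : digraph) (phi : G -> G').
Hypothesis phiE : forall u v, edges (u, v) -> edges (phi u, phi v).

Fact hom_edge_subproof (e : edge G) :
  (phi (source e), phi (target e)) \in @edges G'.
Proof.
by apply/mem_set/phiE; rewrite -surjective_pairing; exact: set_mem (valP e).
Qed.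

Definition hom_edge (e : edge G) : edge G' := SigSub (hom_edge_subproof e).

Definition hom_of_vertex_map : qmap G G' :=
  @QMap G G' phi (fun e => inl (hom_edge e)) (fun=> conj erefl erefl).

Lemma inclusion_hom_of_vertex_map : injective phi -> inclusion hom_of_vertex_map.
Proof.
move=> phi_inj; split=> //; first by move=> e; exists (hom_edge e).
move=> e1 e2 [] /phi_inj h1 /phi_inj h2; apply: val_inj.
by rewrite [LHS]surjective_pairing [RHS]surjective_pairing; congr pair.
Qed.

End HomOfVertexMap.

Definition Delta_edges (n : nat) : set ('I_n.+1 * 'I_n.+1) :=
  [set e : 'I_n.+1 * 'I_n.+1 | (e.1 < e.2)%N].

Fact Delta_irrefl n (u v : 'I_n.+1) : Delta_edges (u, v) -> u <> v.
Proof. by rewrite /Delta_edges /= => + uv; rewrite uv ltnn. Qed.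

Definition Delta (n : nat) : digraph :=
  Digraph (inhabits ord0) (@Delta_irrefl n).

Fact coface_subproof n (i : 'I_n.+2) (u v : Delta n) :
  @edges (Delta n) (u, v) -> @edges (Delta n.+1) (lift i u, lift i v).
Proof.
rewrite /= /Delta_edges /= /bump => uv.
by case: (leqP i u) => iu; case: (leqP i v) => iv; lia.
Qed.

Definition coface n (i : 'I_n.+2) : qmap (Delta n) (Delta n.+1) :=
  hom_of_vertex_map (@coface_subproof n i).

Lemma inclusion_coface n (i : 'I_n.+2) : inclusion (coface i).
Proof. exact/inclusion_hom_of_vertex_map/lift_inj. Qed.

Lemma coface_coface n (i j : 'I_n.+2) : (i <= j)%N ->
  qmap_comp (coface (lift ord0 j)) (coface i) =
  qmap_comp (coface (widen_ord (leqnSn _) i)) (coface j).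
Proof.
move=> ij.
have VE (k : 'I_n.+1) :
    lift (lift ord0 j) (lift i k) = lift (widen_ord (leqnSn _) i) (lift j k).
  by apply: val_inj; rewrite /= !/bump; lia.
apply: qmapP => [k|e]; first exact: VE.
by rewrite /= /comp_mapE /=; congr inl; apply: val_inj; congr pair; exact: VE.
Qed.

(* The edges e range over the i-1 -> i for i = 1, ..., n. *)
Definition degenerate (G : digraph) (n : nat) : set (qmap (Delta n) G) :=
  [set f | exists e : edge (Delta n),
    [/\ (target e = (source e).+1 :> nat)%N,
        mapV f (source e) = mapV f (target e) &
        mapE f e = inr (mapV f (target e))]].

(* With faces d_i, face_face is d_i d_{j+1} = d_j d_i for i <= j. *)
Record semisimplicial := Semisimplicial {
  simplex :> nat -> choiceType;
  face : forall n, 'I_n.+2 -> simplex n.+1 -> simplex n;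
  face_face : forall n (i j : 'I_n.+2) (x : simplex n.+2), (i <= j)%N ->
    face i (face (lift ord0 j) x) = face j (face (widen_ord (leqnSn _) i) x) }.

Section SubSemisimplicial.
Variables (X : semisimplicial) (P : forall n, set (X n)).
Hypothesis Pface : forall n (i : 'I_n.+2) x, P x -> P (face i x).

Definition sub_face n (i : 'I_n.+2) (x : @P n.+1) : @P n :=
  SigSub (mem_set (Pface i (set_mem (valP x)))).

Fact sub_face_face n (i j : 'I_n.+2) (x : @P n.+2) : (i <= j)%N ->
  sub_face i (sub_face (lift ord0 j) x) =
  sub_face j (sub_face (widen_ord (leqnSn _) i) x).
Proof. by move=> ij; apply: val_inj; exact: face_face. Qed.

Definition sub_semisimplicial : semisimplicial :=
  @Semisimplicial (fun n => set_type (@P n) : choiceType) _ sub_face_face.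

End SubSemisimplicial.

Section Singular.
Variable G : digraph.

Fact singular_face_face n (i j : 'I_n.+2) (f : qmap (Delta n.+2) G) :
  (i <= j)%N ->
  qmap_comp (qmap_comp f (coface (lift ord0 j))) (coface i) =
  qmap_comp (qmap_comp f (coface (widen_ord (leqnSn _) i))) (coface j).
Proof. by move=> ij; rewrite !qmap_compA coface_coface. Qed.

Definition singular_maps : semisimplicial :=
  @Semisimplicial (fun n => qmap (Delta n) G)
    (fun n i f => qmap_comp f (coface i)) singular_face_face.

Fact homomorphism_face n (i : 'I_n.+2) (f : singular_maps n.+1) :
  homomorphism f -> homomorphism (face i f).
Proof.
move=> hf; apply: homomorphism_comp => //.
by have [] := inclusion_coface i.
Qed.

Fact inclusion_face n (i : 'I_n.+2) (f : singular_maps n.+1) :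
  inclusion f -> inclusion (face i f).
Proof. move=> hf; exact: inclusion_comp hf (inclusion_coface i). Qed.

Definition singular_homs : semisimplicial :=
  @sub_semisimplicial singular_maps (fun n => @homomorphism (Delta n) G)
    homomorphism_face.

Definition singular_inclusions : semisimplicial :=
  @sub_semisimplicial singular_maps (fun n => @inclusion (Delta n) G)
    inclusion_face.

End Singular.

(* Free modules.  The library only makes {malg R[K]} an R-module when R is
   nontrivial. *)

Definition free_module (R : pzRingType) (K : choiceType) : Type := {malg R[K]}.

Section FreeModule.
Variables (R : pzRingType) (K : choiceType).
Local Notation F := (free_module R K).

HB.instance Definition _ := GRing.Zmodule.on F.

Definition free_scale (c : R) (g : F) : F :=
  [malg k in msupp g => c * mcoeff k g].

Lemma free_scaleE c g k : mcoeff k (free_scale c g) = c * mcoeff k g.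
Proof. by rewrite mcoeffE; case: msuppP; rewrite ?mulr0. Qed.

Fact free_scaleA c d g : free_scale c (free_scale d g) = free_scale (c * d) g.
Proof. by apply/malgP => k; rewrite !free_scaleE mulrA. Qed.

Fact free_scale1 : left_id 1 free_scale.
Proof. by move=> g; apply/malgP => k; rewrite free_scaleE mul1r. Qed.

Fact free_scaleDr : right_distributive free_scale +%R.
Proof.
move=> c g h; apply/malgP => k.
by rewrite [RHS]mcoeffD !free_scaleE [in LHS]mcoeffD mulrDr.
Qed.

Fact free_scaleDl g : {morph free_scale^~ g : c d / c + d}.
Proof.
move=> c d; apply/malgP => k.
by rewrite [RHS]mcoeffD !free_scaleE mulrDl.
Qed.

HB.instance Definition _ := GRing.Zmodule_isLmodule.Build R F
  free_scaleA free_scale1 free_scaleDr free_scaleDl.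

Definition free_gen (k : K) : F := mkmalgU k (1 : R).

Lemma mcoeff_scale c (g : F) k : mcoeff k (c *: g) = c * mcoeff k g.
Proof. exact: free_scaleE. Qed.

Lemma free_decomp (g : F) : g = \sum_(k <- msupp g) mcoeff k g *: free_gen k.
Proof.
rewrite [LHS]monalgE; apply: eq_bigr => k _; apply/malgP => l.
by rewrite mcoeff_scale !mcoeffU mulrnAr mulr1.
Qed.

Lemma free_linear0 (V : lmodType R) (f : {linear F -> V}) :
  (forall k, f (free_gen k) = 0) -> forall g, f g = 0.
Proof.
move=> f0 g; rewrite (free_decomp g) linear_sum big1 // => k _.
by rewrite linearZ_LR f0 scaler0.
Qed.

Variables (V : lmodType R) (h : K -> V).

Definition free_extend (g : F) : V := \sum_(k <- msupp g) mcoeff k g *: h k.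

Lemma free_extendEw (g : F) (D : {fset K}) : (msupp g `<=` D)%fset ->
  free_extend g = \sum_(k <- D) mcoeff k g *: h k.
Proof.
move=> gD; rewrite /free_extend; apply/big_fset_incl => // k kD kg.
by rewrite mcoeff_outdom ?scale0r.
Qed.

Fact free_extend_linear : linear free_extend.
Proof.
move=> c g1 g2; pose D := (msupp g1 `|` msupp g2)%fset.
have g1D : (msupp g1 `<=` D)%fset by exact: fsubsetUl.
have g2D : (msupp g2 `<=` D)%fset by exact: fsubsetUr.
have gD : (msupp (c *: g1 + g2 : F) `<=` D)%fset.
  apply/fsubsetP => k; rewrite -mcoeff_neq0 mcoeffD mcoeff_scale in_fsetU.
  by case: (msuppP g1); case: (msuppP g2); rewrite // mulr0 addr0 eqxx.
rewrite (free_extendEw gD) (free_extendEw g1D) (free_extendEw g2D).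
rewrite scaler_sumr -big_split /=; apply: eq_bigr => k _.
by rewrite mcoeffD mcoeff_scale scalerDl scalerA.
Qed.

HB.instance Definition _ :=
  GRing.isLinear.Build R F V *:%R free_extend free_extend_linear.

Lemma free_extend_gen k : free_extend (free_gen k) = h k.
Proof.
rewrite (@free_extendEw _ [fset k]%fset) ?msuppU_le //.
by rewrite big_seq_fset1 mcoeffUU scale1r.
Qed.

End FreeModule.

Section LmodQuotient.
Variables (R : pzRingType) (V : lmodType R) (S : {pred V}).
Hypothesis Ssub : submod_closed S.

Definition submod_set & submod_closed S : {pred V} := S.

HB.instance Definition _ :=
  GRing.isSubmodClosed.Build R V (submod_set Ssub) Ssub.

Definition lmod_quot : Type := Quotient.quot (submod_set Ssub).

Local Notation Q := lmod_quot.
Local Open Scope quotient_scope.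

HB.instance Definition _ := GRing.Zmodule.on Q.
HB.instance Definition _ := EqQuotient.on Q.
HB.instance Definition _ := ZmodQuotient.on Q.

Definition quot_scale (c : R) (x : Q) : Q := \pi_Q (c *: repr x).

Fact pi_scale c (x : V) : quot_scale c (\pi_Q x) = \pi_Q (c *: x).
Proof.
apply/eqP; rewrite /quot_scale -Quotient.idealrBE -scalerBr.
have Sx : repr (\pi_Q x) - x \in submod_set Ssub.
  by rewrite Quotient.idealrBE; apply/eqP; exact: reprK.
exact: rpredZ.
Qed.

Fact quot_scaleA c d x : quot_scale c (quot_scale d x) = quot_scale (c * d) x.
Proof. by rewrite -[x]reprK [quot_scale d _]pi_scale !pi_scale scalerA. Qed.

Fact quot_scale1 : left_id 1 quot_scale.
Proof. by move=> x; rewrite -[x]reprK pi_scale scale1r. Qed.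

Fact quot_scaleDr : right_distributive quot_scale +%R.
Proof.
move=> c x y; rewrite -[x]reprK -[y]reprK.
by rewrite -[in LHS]pi_addr !pi_scale -pi_addr scalerDr.
Qed.

Fact quot_scaleDl x : {morph quot_scale^~ x : c d / c + d}.
Proof.
by move=> c d; rewrite -[x]reprK !pi_scale -pi_addr scalerDl.
Qed.

HB.instance Definition _ := GRing.Zmodule_isLmodule.Build R Q
  quot_scaleA quot_scale1 quot_scaleDr quot_scaleDl.

End LmodQuotient.

Section Homology.
Variables (R : pzRingType) (A B C : lmodType R).
Variables (f : {linear A -> B}) (g : {linear B -> C}).

Definition kernel : {pred B} := [pred x | g x == 0].

Fact kernel_submod : submod_closed kernel.
Proof.
split=> [|c x y]; rewrite !inE ?linear0 // => /eqP gx /eqP gy.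
by rewrite linearP gx gy scaler0 addr0.
Qed.

HB.instance Definition _ := GRing.isSubmodClosed.Build R B kernel kernel_submod.

Record cycle := Cycle { cycle_val : B; _ : cycle_val \in kernel }.

HB.instance Definition _ := [isSub for cycle_val].
HB.instance Definition _ := [Choice of cycle by <:].
HB.instance Definition _ := [SubChoice_isSubLmodule of cycle by <:].

Definition boundaries : {pred cycle} :=
  [pred z | `[< exists a, f a = val z >]].

Fact boundaries_submod : submod_closed boundaries.
Proof.
split=> [|c x y].
  by rewrite inE; exists 0; rewrite linear0.
rewrite !inE => -[a fa] [b fb].
by exists (c *: a + b); rewrite !linearP fa fb.
Qed.

Definition homology_at : lmodType R := lmod_quot boundaries_submod.

End Homology.

Section Complex.
Variables (R : comPzRingType) (X : semisimplicial).

Definition chain (n : nat) : lmodType R := free_module R (X n).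

(* For n = 0 the target is the junk value C_0 standing for C_{-1} = 0. *)
Definition differential (n : nat) : chain n -> chain n.-1 :=
  match n with
  | 0 => fun=> 0
  | m.+1 => free_extend (fun x : X m.+1 =>
      \sum_(i < m.+2) (-1) ^+ i *: free_gen R (face i x))
  end.

Fact differential_linear n : linear (@differential n).
Proof.
case: n => [|n] c x y; first by rewrite scaler0 addr0.
exact: free_extend_linear.
Qed.

HB.instance Definition _ n := GRing.isLinear.Build R (chain n) (chain n.-1) *:%R
  (@differential n) (@differential_linear n).

Arguments differential : simpl never.

Lemma differential_gen n (x : X n.+1) :
  @differential n.+1 (free_gen R x) =
  \sum_(i < n.+2) (-1) ^+ i *: free_gen R (face i x).
Proof. exact: free_extend_gen. Qed.

Lemma differential_differential n (c : chain n.+1) :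
  differential (differential c) = 0.
Proof.
case: n c => [//|n] c.
have dd_gen (x : X n.+2) :
    differential (differential (free_gen R x : chain n.+2)) = 0; last first.
  exact: (free_linear0 (f := @differential n.+1 \o @differential n.+2) dd_gen).
rewrite differential_gen linear_sum.
under eq_bigr => j _ do rewrite linearZ_LR /= differential_gen scaler_sumr.
have split_lt (j : 'I_n.+3) :
    \sum_(i < n.+2) (-1) ^+ j *: ((-1) ^+ i *: free_gen R (face i (face j x))) =
    \sum_(i < n.+2 | (i < j)%N)
      (-1) ^+ j *: ((-1) ^+ i *: free_gen R (face i (face j x))) +
    \sum_(i < n.+2 | (j <= i)%N)
      (-1) ^+ j *: ((-1) ^+ i *: free_gen R (face i (face j x))).
  rewrite (bigID (fun i : 'I_n.+2 => i < j)%N) /=; congr (_ + _).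
  by apply: eq_bigl => i; rewrite -leqNgt.
under eq_bigr => j _ do rewrite split_lt.
rewrite big_split /= big_ord_recl [X in X + _ + _]big_pred0 // add0r.
rewrite [X in _ + X]big_ord_recr /= [X in _ + (_ + X)]big_pred0; last first.
  by move=> i; rewrite leqNgt ltn_ord.
rewrite addr0 [X in _ + X](exchange_big_dep xpredT) //= -big_split /=.
rewrite big1 ?scaler0 // => j _.
apply/eqP; rewrite addr_eq0 -sumrN; apply/eqP.
apply: eq_big => [i|i]; first by rewrite /= /bump /= add1n ltnS.
rewrite /= /bump /= add1n ltnS => ij; rewrite face_face // exprS mulN1r scaleNr.
by rewrite !scalerA mulrC.
Qed.

Definition homology (n : nat) : lmodType R :=
  homology_at (@differential n.+1) (@differential n).

End Complex.

Definition lmod_iso (R : pzRingType) (U V : lmodType R) : Prop :=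
  exists f : {linear U -> V}, bijective f.

(* Main.v *)
From HB Require Import structures.
Require Import Defs.
From mathcomp Require Import all_boot all_algebra boolp classical_sets.
From mathcomp Require Import ring_quotient zify.

Set Implicit Arguments.
Unset Strict Implicit.
Unset Printing Implicit Defensive.

Import GRing.Theory.

Local Open Scope classical_set_scope.
Local Open Scope ring_scope.

(** A simplex of [G] is a sequence of vertices [x_0, ..., x_n] in which, for
    [k < l], either [x_k = x_l] or [x_k -> x_l] is an edge; it is degenerate iff
    [x_p = x_{p+1}] for some [p].  Without double edges, [x_k = x_m] forces
    [x_k = x_l] for [k < l < m], so the non-degenerate simplices are the
    sequences with distinct entries, i.e. the homomorphisms, i.e. the inclusions.
    For the homology, let [h] send a degenerate simplex whose first repetition is
    at [p] to [(-1)^p s_p x], and the other simplices to [0].  A face [d_i] with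
    [i < p] moves the first repetition to [p - 1] (it creates no earlier one, for
    lack of double edges), [d_p] and [d_{p+1}] cancel, and the later faces leave
    it at [p]; hence [d h + h d] is the projection onto the degenerate chains
    along the span of the homomorphisms, which is thus a deformation retract. *)

(** * Homology classes and induced maps *)

Section HomologyPi.
Variables (R : pzRingType) (A B C : lmodType R).
Variables (f : {linear A -> B}) (g : {linear B -> C}).

Definition homology_pi (z : Defs.cycle g) : homology_at f g :=
  (\pi_(lmod_quot (boundaries_submod f g)) z)%qT.

Lemma homology_pi_linear : linear homology_pi.
Proof.
move=> c x y; rewrite /homology_pi Quotient.pi_add.
by congr (_ + _); rewrite -[LHS]pi_scale.
Qed.

Lemma homology_pi_surj (x : homology_at f g) : exists z, homology_pi z = x.
Proof. by exists (repr x); exact: reprK. Qed.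

Lemma homology_piP (x y : Defs.cycle g) :
  homology_pi x = homology_pi y <-> exists a, f a = val x - val y.
Proof.
have -> : (homology_pi x = homology_pi y) <-> (x - y \in @boundaries R A B C f g).
  by rewrite (Quotient.idealrBE (submod_set (boundaries_submod f g)));
    split=> /eqP.
by split=> /asboolP.
Qed.

End HomologyPi.

Section HomologyMap.
Variables (R : pzRingType) (A B C A' B' C' : lmodType R).
Variables (f : {linear A -> B}) (g : {linear B -> C}).
Variables (f' : {linear A' -> B'}) (g' : {linear B' -> C'}).
Variable u : {linear B -> B'}.
Hypothesis uZ : forall z, g z = 0 -> g' (u z) = 0.
Hypothesis uB : forall a, exists a', f' a' = u (f a).

Fact cycle_map_subproof (z : Defs.cycle g) : u (val z) \in kernel g'.
Proof. by rewrite inE; apply/eqP/uZ/eqP; have := valP z; rewrite inE. Qed.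

Definition cycle_map (z : Defs.cycle g) : Defs.cycle g' :=
  Cycle (cycle_map_subproof z).

Fact cycle_map_linear : linear cycle_map.
Proof. by move=> c x y; apply: val_inj; rewrite /= !linearP. Qed.

Definition homology_map (x : homology_at f g) : homology_at f' g' :=
  homology_pi f' (cycle_map (projT1 (cid (homology_pi_surj x)))).

Lemma homology_map_pi z :
  homology_map (homology_pi f z) = homology_pi f' (cycle_map z).
Proof.
rewrite /homology_map; case: cid => z' /= /homology_piP [a fa].
by apply/homology_piP; have [a' fa'] := uB a; exists a'; rewrite fa' fa linearB.
Qed.

Fact homology_map_linear : linear homology_map.
Proof.
move=> c x y.
have [zx <-] := homology_pi_surj x; have [zy <-] := homology_pi_surj y.
rewrite -homology_pi_linear !homology_map_pi cycle_map_linear.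
exact: homology_pi_linear.
Qed.

End HomologyMap.

Section HomologyIso.
Variables (R : pzRingType) (A B C A' B' C' : lmodType R).
Variables (f : {linear A -> B}) (g : {linear B -> C}).
Variables (f' : {linear A' -> B'}) (g' : {linear B' -> C'}).
Variables (u : {linear B -> B'}) (v : {linear B' -> B}).
Hypothesis uZ : forall z, g z = 0 -> g' (u z) = 0.
Hypothesis uB : forall a, exists a', f' a' = u (f a).
Hypothesis vZ : forall z, g' z = 0 -> g (v z) = 0.
Hypothesis vB : forall a, exists a', f a' = v (f' a).
Hypothesis vu : forall z, g z = 0 -> exists a, f a = v (u z) - z.
Hypothesis uv : forall z, g' z = 0 -> exists a, f' a = u (v z) - z.

(** The hypotheses keep one degree of a chain homotopy equivalence: each composite moves a cycle by
    a boundary only, so the induced maps are mutually inverse. *)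
Lemma homology_at_iso : lmod_iso (homology_at f g) (homology_at f' g').
Proof.
pose linear_u := GRing.isLinear.Build R _ _ *:%R (homology_map f' uZ)
  (homology_map_linear uZ uB).
pose hu : {linear homology_at f g -> homology_at f' g'} :=
  HB.pack (homology_map f' uZ) linear_u.
exists hu, (homology_map f vZ) => x.
- have [z <-] := homology_pi_surj x.
  rewrite /= !(homology_map_pi uZ uB, homology_map_pi vZ vB).
  by apply/homology_piP/vu/eqP; have := valP z; rewrite inE.
- have [z <-] := homology_pi_surj x.
  rewrite /= !(homology_map_pi uZ uB, homology_map_pi vZ vB).
  by apply/homology_piP/uv/eqP; have := valP z; rewrite inE.
Qed.

End HomologyIso.

(** * Deformation retracts onto sub-semisimplicial objects *)

Lemma free_linear_eq (R : pzRingType) (K : choiceType) (V : lmodType R)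
    (f g : {linear free_module R K -> V}) :
  (forall k, f (free_gen R k) = g (free_gen R k)) -> f =1 g.
Proof.
move=> fg c; apply/subr0_eq.
by apply: (free_linear0 (f := f \- g)) => k /=; rewrite fg subrr.
Qed.

Arguments differential : simpl never.

Section SubHomology.
Variables (R : comPzRingType) (X : semisimplicial) (P : forall n, set (X n)).
Hypothesis Pface : forall n (i : 'I_n.+2) (x : X n.+1), P x -> P (face i x).
Local Notation S := (sub_semisimplicial Pface).
Local Notation d := differential.

Definition sub_incl n : chain R S n -> chain R X n :=
  free_extend (fun x : S n => free_gen R (val x)).
HB.instance Definition _ n := GRing.isLinear.Build R (chain R S n)
  (chain R X n) *:%R (@sub_incl n) (free_extend_linear _).

(** Projection along the span of the simplices outside [P]. Their faces may lie in [P], so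
    commutation with [d] needs the homotopy; see [sub_retr_d]. *)
Definition sub_retr n : chain R X n -> chain R S n :=
  free_extend (fun x : X n =>
    if insub x is Some y then free_gen R (y : S n) else 0).
HB.instance Definition _ n := GRing.isLinear.Build R (chain R X n)
  (chain R S n) *:%R (@sub_retr n) (free_extend_linear _).

Lemma sub_incl_gen n (x : S n) :
  sub_incl (free_gen R x : chain R S n) = free_gen R (val x).
Proof. exact: free_extend_gen. Qed.

Lemma sub_retr_val n (x : S n) :
  sub_retr (free_gen R (val x) : chain R X n) = free_gen R x.
Proof. by rewrite /sub_retr free_extend_gen valK. Qed.

Lemma sub_retr_out n (x : X n) :
  ~ P x -> sub_retr (free_gen R x : chain R X n) = 0.
Proof.
by move=> Px; rewrite /sub_retr free_extend_gen insubN //; apply/negP => /set_mem.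
Qed.

Lemma sub_inclK n : cancel (@sub_incl n) (@sub_retr n).
Proof.
apply: (free_linear_eq (f := @sub_retr n \o @sub_incl n) (g := idfun)) => x /=.
by rewrite sub_incl_gen sub_retr_val.
Qed.

Lemma sub_incl_d n (c : chain R S n.+1) : sub_incl (d c) = d (sub_incl c).
Proof.
move: c; apply: (free_linear_eq (f := @sub_incl n \o @d R S n.+1)
  (g := @d R X n.+1 \o @sub_incl n.+1)) => x /=.
rewrite sub_incl_gen !differential_gen linear_sum; apply: eq_bigr => i _.
by rewrite linearZ_LR /= sub_incl_gen.
Qed.

Variable h : forall n, {linear chain R X n -> chain R X n.+1}.
Hypothesis P0 : forall x : X 0, P x.
Hypothesis hP : forall n (x : X n), P x -> h n (free_gen R x) = 0.
Hypothesis hNP : forall n (x : X n.+1), ~ P x ->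
  d (h n.+1 (free_gen R x)) + h n (d (free_gen R x : chain R X n.+1)) =
  free_gen R x.

Lemma sub_incl_retr0 (c : chain R X 0) : sub_incl (sub_retr c) = c.
Proof.
move: c; apply: (free_linear_eq (f := @sub_incl 0 \o @sub_retr 0)
  (g := idfun)) => x /=.
by rewrite (sub_retr_val (SigSub (mem_set (P0 x)) : S 0)) sub_incl_gen.
Qed.

Lemma sub_homotopy0 (c : chain R X 0) : h 0 c = 0.
Proof. by apply: free_linear0 c => x; exact: hP. Qed.

(** On a simplex of [P] both homotopy terms vanish, as its faces lie in [P] again; on any other
    simplex both sides are zero, by [hNP]. *)
Lemma sub_homotopy n (c : chain R X n.+1) :
  sub_incl (sub_retr c) = c - (d (h n.+1 c) + h n (d c)).
Proof.
move: c; apply: (free_linear_eq (f := @sub_incl n.+1 \o @sub_retr n.+1)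
  (g := idfun \- ((@d R X n.+2 \o h n.+1) \+ (h n \o @d R X n.+1)))) => x /=.
have [Px|NPx] := pselect (P x); last first.
  by rewrite sub_retr_out // linear0 hNP // subrr.
have Exs : x = val (SigSub (mem_set Px) : S n.+1) by [].
rewrite [in LHS]Exs sub_retr_val sub_incl_gen -Exs hP // linear0 add0r.
rewrite differential_gen linear_sum big1 ?subr0 // => i _.
by rewrite linearZ_LR /= hP ?scaler0 //; exact: Pface.
Qed.

(** After the injective inclusion, both sides become [d c - d (h (d c))], since [d] squares to
    zero. *)
Lemma sub_retr_d n (c : chain R X n.+1) : sub_retr (d c) = d (sub_retr c).
Proof.
apply: (can_inj (@sub_inclK n)); rewrite sub_incl_d sub_homotopy linearB.
rewrite linearD /= differential_differential add0r.
case: n c => [|n] c; first by rewrite sub_incl_retr0 sub_homotopy0 linear0 subr0.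
by rewrite sub_homotopy differential_differential linear0 addr0.
Qed.

Lemma sub_homology_iso n : lmod_iso (homology R S n) (homology R X n).
Proof.
apply: (homology_at_iso (u := @sub_incl n) (v := @sub_retr n)).
- by case: n => [//|n] z dz; rewrite /= -sub_incl_d [d _]dz linear0.
- by move=> a; exists (sub_incl a); rewrite /= sub_incl_d.
- by case: n => [//|n] z dz; rewrite /= -sub_retr_d [d _]dz linear0.
- by move=> a; exists (sub_retr a); rewrite /= sub_retr_d.
- by move=> z _; exists 0; rewrite /= sub_inclK linear0 subrr.
(* In degree 0 inclusion after retraction is the identity; above, it sends a cycle [z] to
   [z - d (h z)], whence the witness [- h z]. *)
case: n => [|n] z dz; first by exists 0; rewrite /= sub_incl_retr0 linear0 subrr.
exists (- h n.+1 z); rewrite /= sub_homotopy [d z]dz linear0 addr0 linearN /=.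
by rewrite addrAC subrr add0r.
Qed.

End SubHomology.

(** Equal predicates give equal objects, the closure proofs agreeing by proof irrelevance, so no
    comparison of chain complexes has to be built. *)
Lemma eq_sub_semisimplicial (X : semisimplicial) (P Q : forall n, set (X n))
    (Pface : forall n (i : 'I_n.+2) (x : X n.+1), P n.+1 x -> P n (face i x))
    (Qface : forall n (i : 'I_n.+2) (x : X n.+1), Q n.+1 x -> Q n (face i x)) :
  (forall n, P n = Q n) -> sub_semisimplicial Pface = sub_semisimplicial Qface.
Proof.
move=> eqPQ; have PQ := functional_extensionality_dep eqPQ; subst Q.
by congr sub_semisimplicial; exact: Prop_irrelevance.
Qed.

Lemma lmod_iso_refl (R : pzRingType) (U : lmodType R) : lmod_iso U U.
Proof. by exists idfun; exists id. Qed.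

(** * Maps of digraphs as vertex functions *)

Lemma edge_ext (G : digraph) (e1 e2 : edge G) :
  source e1 = source e2 -> target e1 = target e2 -> e1 = e2.
Proof.
move=> s12 t12; apply: val_inj.
by rewrite [LHS]surjective_pairing [RHS]surjective_pairing; congr pair.
Qed.

Lemma edges_edge (G : digraph) (e : edge G) : edges (source e, target e).
Proof. by rewrite -surjective_pairing; exact: set_mem (valP e). Qed.

Lemma source_neq_target (G : digraph) (e : edge G) : source e <> target e.
Proof. exact/edges_irrefl/edges_edge. Qed.

(* Digraphs have no loops, so whether an edge is collapsed can be read off its
   endpoints. *)
Lemma qmap_ext (G G' : digraph) (f g : qmap G G') : mapV f =1 mapV g -> f = g.
Proof.
move=> fg; apply: qmapP => // e.
have := mapE_compat f e; have := mapE_compat g e.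
case: (mapE f e) (mapE g e) => [e1|v1] [e2|v2].
- by move=> [s2 t2] [s1 t1]; congr inl; apply: edge_ext; rewrite ?s1 ?t1 fg.
- move=> [s2 t2] [s1 t1]; case: (@source_neq_target _ e1).
  by rewrite s1 t1 !fg -s2.
- move=> [s2 t2] [s1 t1]; case: (@source_neq_target _ e2).
  by rewrite s2 t2 -!fg -s1.
by move=> [-> _] [-> _]; rewrite fg.
Qed.

Lemma qmap_edge (G G' : digraph) (f : qmap G G') u v : edges (u, v) ->
  mapV f u = mapV f v \/ edges (mapV f u, mapV f v).
Proof.
move=> uv; pose e : edge G := SigSub (mem_set uv).
have := mapE_compat f e; case: (mapE f e) => [e'|w] [s t].
  by right; rewrite -[u]/(source e) -[v]/(target e) -s -t; exact: edges_edge.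
by left; rewrite -[u]/(source e) -[v]/(target e) -s.
Qed.

Section WeakVertexMap.
Variables (G G' : digraph) (phi : G -> G').
Hypothesis phiE : forall u v, edges (u, v) ->
  phi u = phi v \/ edges (phi u, phi v).

Fact weak_edge_subproof (e : edge G) : phi (source e) <> phi (target e) ->
  (phi (source e), phi (target e)) \in @edges G'.
Proof. by move=> ne; apply/mem_set; case: (phiE (edges_edge e)). Qed.

Definition weak_edge (e : edge G) : edge G' + G' :=
  match pselect (phi (source e) = phi (target e)) with
  | left _ => inr (phi (target e))
  | right ne => inl (SigSub (weak_edge_subproof ne))
  end.

Fact weak_edge_compat (e : edge G) :
  match weak_edge e with
  | inl e' => source e' = phi (source e) /\ target e' = phi (target e)
  | inr v => v = phi (source e) /\ v = phi (target e)
  end.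
Proof. by rewrite /weak_edge; case: pselect. Qed.

(** Converse to [qmap_edge]; it serves to build the codegeneracies, which collapse an edge. *)
Definition qmap_of_vertex_map : qmap G G' := QMap weak_edge_compat.

End WeakVertexMap.

(** * Simplices as vertex sequences *)

Section SimplexVertices.
Variable G : digraph.

(** Natural number indices leave index arithmetic to [lia]; an index above [n] reads vertex 0. *)
Definition vtx n (x : qmap (Delta n) G) (k : nat) : G := mapV x (inord k).

Lemma simplex_ext n (x y : qmap (Delta n) G) :
  (forall k, (k <= n)%N -> vtx x k = vtx y k) -> x = y.
Proof.
move=> xy; apply: qmap_ext => k.
by have := xy k (ltn_ord k); rewrite /vtx inord_val.
Qed.

Lemma vtx_edge n (x : qmap (Delta n) G) k l : (k < l <= n)%N ->
  vtx x k = vtx x l \/ edges (vtx x k, vtx x l).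
Proof.
by move=> kl; apply: qmap_edge; rewrite /= /Delta_edges /= !inordK; lia.
Qed.

Lemma vtx_face n (x : qmap (Delta n.+1) G) (i k : nat) :
  (i <= n.+1)%N -> (k <= n)%N ->
  vtx (face (s := singular_maps G) (inord i) x) k = vtx x (bump i k).
Proof.
move=> le_i le_k; rewrite /vtx /=; congr (mapV x _); apply: val_inj.
by rewrite /= !inordK // /bump; lia.
Qed.

Fact codegeneracy_subproof n (p : 'I_n.+1) (u v : Delta n.+1) :
  edges (u, v) ->
  (inord (unbump p u) : Delta n) = inord (unbump p v) \/
  @edges (Delta n) (inord (unbump p u), inord (unbump p v)).
Proof.
case: p u v => p lt_p [u lt_u] [v lt_v]; rewrite /= /Delta_edges /= => uv.
have [->|ne] := eqVneq (unbump p u) (unbump p v); first by left.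
by right; rewrite /unbump in ne *; rewrite !inordK; lia.
Qed.

(** The standard codegeneracy: [unbump p] is monotone and takes the value [p] at both [p] and
    [p.+1]. *)
Definition codegeneracy n (p : 'I_n.+1) : qmap (Delta n.+1) (Delta n) :=
  qmap_of_vertex_map (@codegeneracy_subproof n p).

Definition degeneracy n (p : nat) (x : qmap (Delta n) G) :
  qmap (Delta n.+1) G := qmap_comp x (codegeneracy (inord p)).

Lemma vtx_degeneracy n (x : qmap (Delta n) G) (p k : nat) :
  (p <= n)%N -> (k <= n.+1)%N -> vtx (degeneracy p x) k = vtx x (unbump p k).
Proof. by move=> le_p le_k; rewrite /vtx /= !inordK. Qed.

Definition repeat_at n (x : qmap (Delta n) G) (p : nat) :=
  (p < n)%N /\ vtx x p = vtx x p.+1.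

Definition first_repeat n (x : qmap (Delta n) G) (p : nat) :=
  repeat_at x p /\ forall q, (q < p)%N -> ~ repeat_at x q.

Lemma first_repeat_uniq n (x : qmap (Delta n) G) p q :
  first_repeat x p -> first_repeat x q -> p = q.
Proof.
move=> [rp fp] [rq fq]; case: (ltngtP p q) => // [pq|qp].
- by case: (fq _ pq).
- by case: (fp _ qp).
Qed.

Lemma repeat_first n (x : qmap (Delta n) G) p :
  repeat_at x p -> exists q, first_repeat x q.
Proof.
move=> rp; have exr : exists q, `[<repeat_at x q>] by exists p; apply/asboolP.
case: (ex_minnP exr) => q /asboolP rq minq; exists q; split=> // r rq'.
by move=> /asboolP /minq; rewrite leqNgt rq'.
Qed.

(** If [x] agrees at [p] and [p.+1], the edge between them must be collapsed, as its image would
    otherwise be a loop. *)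
Lemma degenerateP n (x : qmap (Delta n) G) :
  degenerate x <-> exists p, repeat_at x p.
Proof.
split=> [[e [te xe _]]|[p [lt_p xp]]].
  exists (source e); split; first by rewrite -te -ltnS.
  by rewrite /vtx -te !inord_val.
have e_edge : ((inord p : 'I_n.+1), (inord p.+1 : 'I_n.+1)) \in @edges (Delta n).
  by apply/mem_set; rewrite /= /Delta_edges /= !inordK; lia.
pose e : edge (Delta n) := SigSub e_edge.
exists e; split; rewrite /e /source /target /=.
- by rewrite !inordK; lia.
- exact: xp.
have := mapE_compat x e; case: (mapE x e) => [e' [s t]|v [_ ->] //].
by case: (@source_neq_target _ e'); rewrite s t.
Qed.

Lemma hom_not_degenerate n (x : qmap (Delta n) G) :
  homomorphism x -> ~ degenerate x.
Proof. by move=> hx [e [_ _]]; have [e' ->] := hx e. Qed.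

(** Vertices [k < l] are joined by an edge, whose image has distinct ends; injectivity on edges
    follows, as an edge is determined by its ends. *)
Lemma hom_inclusion n (x : qmap (Delta n) G) : homomorphism x -> inclusion x.
Proof.
move=> hx; have neq (k l : 'I_n.+1) : (k < l)%N -> mapV x k <> mapV x l.
  move=> kl.
  pose e : edge (Delta n) := SigSub (mem_set (kl : @edges (Delta n) (k, l))).
  have [e' xe] := hx e; have := mapE_compat x e; rewrite xe => -[s t] xkl.
  by case: (@source_neq_target _ e'); rewrite s t.
have injV : injective (mapV x).
  move=> k l xkl.
  case: (ltngtP (k : 'I_n.+1) (l : 'I_n.+1)) => [kl|lk|/val_inj //].
  - by case: (neq _ _ kl).
  - by case: (neq _ _ lk).
split=> // e1 e2 x12; have [e xe1] := hx e1; have xe2 := xe1; rewrite x12 in xe2.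
have := mapE_compat x e1; have := mapE_compat x e2.
rewrite xe1 xe2 => -[s2 t2] [s1 t1].
by apply: edge_ext; apply: injV; rewrite -?s1 -?t1.
Qed.

(** * Consequences of the absence of double edges *)

Hypothesis G_no_double_edge : ~ has_double_edge G.

(** Otherwise [x_k -> x_l] and [x_l -> x_m = x_k] form a double edge. Later uses of the hypothesis
    on [G] all go through this lemma. *)
Lemma vtx_eq_between n (x : qmap (Delta n) G) k l m :
  (k < l < m)%N -> (m <= n)%N ->
  vtx x k = vtx x m -> vtx x k = vtx x l.
Proof.
move=> /andP[kl lm] mn xkm; apply: contrapT => ne.
have [//|ekl] : vtx x k = vtx x l \/ edges (vtx x k, vtx x l).
  by apply: vtx_edge; lia.
have [eq|elm] : vtx x l = vtx x m \/ edges (vtx x l, vtx x m).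
  by apply: vtx_edge; lia.
- by apply: ne; rewrite eq.
- by apply: G_no_double_edge; exists (vtx x k), (vtx x l); rewrite {3}xkm.
Qed.

(** A collapsed edge [k -> l] gives [x_k = x_l], hence [x_k = x_{k+1}] by [vtx_eq_between]. *)
Lemma not_degenerate_hom n (x : qmap (Delta n) G) :
  ~ degenerate x -> homomorphism x.
Proof.
move=> ndx e; have := mapE_compat x e.
case: (mapE x e) => [e' _|v]; first by exists e'.
move=> [-> xe]; case: ndx; apply/degenerateP; exists (source e).
have lt_e : (source e < target e)%N := edges_edge e.
have le_e : (target e <= n)%N by rewrite -ltnS.
split; first lia.
case: (ltngtP (source e).+1 (target e)) lt_e => // [lt_e _|eq_e _].
  apply: (@vtx_eq_between _ _ _ _ (target e)); rewrite ?lt_e ?ltnSn //.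
  by rewrite /vtx !inord_val.
by rewrite /vtx eq_e !inord_val.
Qed.

(** * Faces, degeneracies and the first repetition *)

Local Notation fc i x := (face (s := singular_maps G) (inord i) x).

(** The only adjacent pair that deleting [x_i] can create is [x_{i-1}, x_{i+1}]; if equal, both
    would equal [x_i], a repetition before [p]. *)
Lemma first_repeat_face_lt n (x : qmap (Delta n.+1) G) p i :
  first_repeat x p -> (i < p)%N -> first_repeat (fc i x : qmap (Delta n) G) p.-1.
Proof.
move=> [[lt_p xp] fp] lt_ip; split=> [|q lt_q [lt_qn]].
  split; first lia.
  rewrite !vtx_face; try lia.
  by have [-> ->] : bump i p.-1 = p /\ bump i p.-1.+1 = p.+1 by rewrite /bump; lia.
rewrite !vtx_face; try lia.
have nrep r : (r < p)%N -> vtx x r <> vtx x r.+1.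
  by move=> lt_r xr; apply: (fp r lt_r); split=> //; lia.
(* The pair [q, q.+1] of the face comes from before the deleted index, from around it, or from after
   it. *)
have [[-> ->]|[iq [-> ->]]|[iq [-> ->]]] :
    [\/ bump i q = q /\ bump i q.+1 = q.+1,
        i = q.+1 /\ (bump i q = q /\ bump i q.+1 = q.+2) |
        (i <= q)%N /\ (bump i q = q.+1 /\ bump i q.+1 = q.+2)].
  rewrite /bump; case: (ltngtP i q.+1) => [|iq|iq].
  - by move=> iq; constructor 3; lia.
  - by constructor 1; lia.
  - by constructor 2; lia.
- by apply: nrep; lia.
- move=> xq; apply: (nrep q); first lia.
  by apply: (@vtx_eq_between _ _ _ _ q.+2) => //; lia.
- by apply: nrep; lia.
Qed.

Lemma first_repeat_face_gt n (x : qmap (Delta n.+1) G) p i :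
  first_repeat x p -> (p.+1 < i <= n.+1)%N ->
  first_repeat (fc i x : qmap (Delta n) G) p.
Proof.
move=> [[lt_p xp] fp] lt_pi.
have vf q : (q <= p.+1)%N -> vtx (fc i x : qmap (Delta n) G) q = vtx x q.
  by move=> qp; rewrite vtx_face; [congr vtx; rewrite /bump; lia|lia|lia].
split=> [|q lt_q [lt_qn]]; first by split; [lia|rewrite !vf].
by rewrite !vf; [move=> xq; apply: (fp q) => //; split=> //; lia|lia|lia].
Qed.

(** The two faces differ at most at position [p], where they carry [x_{p+1}] and [x_p]. *)
Lemma face_repeat n (x : qmap (Delta n.+1) G) p :
  repeat_at x p -> fc p x = fc p.+1 x.
Proof.
move=> [lt_p xp]; apply: simplex_ext => k le_k; rewrite !vtx_face; try lia.
case: (ltngtP k p) => [kp|kp|->].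
- by congr vtx; rewrite /bump; lia.
- by congr vtx; rewrite /bump; lia.
- by have [-> ->] : bump p p = p.+1 /\ bump p.+1 p = p by rewrite /bump; lia.
Qed.

(** This and the next two lemmas are the simplicial identities for [d_i s_p], checked on
    vertices. *)
Lemma face_degeneracy_lt n (x : qmap (Delta n.+1) G) p i :
  (i < p <= n.+1)%N -> fc i (degeneracy p x) = degeneracy p.-1 (fc i x).
Proof.
move=> ip; apply: simplex_ext => k le_k.
rewrite vtx_face ?vtx_degeneracy ?vtx_face; rewrite ?/bump ?/unbump; try lia.
by congr vtx; lia.
Qed.

Lemma face_degeneracy_id n (x : qmap (Delta n) G) p i :
  (p <= i <= p.+1)%N -> (p <= n)%N -> fc i (degeneracy p x) = x.
Proof.
move=> ip pn; apply: simplex_ext => k le_k.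
rewrite vtx_face ?vtx_degeneracy; rewrite ?/bump; try lia.
by congr vtx; rewrite /unbump; lia.
Qed.

Lemma face_degeneracy_gt n (x : qmap (Delta n.+1) G) p i :
  (p < i <= n.+1)%N -> fc i.+1 (degeneracy p x) = degeneracy p (fc i x).
Proof.
move=> ip; apply: simplex_ext => k le_k.
rewrite vtx_face ?vtx_degeneracy ?vtx_face; rewrite ?/bump ?/unbump; try lia.
by congr vtx; lia.
Qed.

(** Deleting one of two equal neighbours and repeating the other restores [x]; thus [x] itself
    appears in [d h x]. *)
Lemma degeneracy_face_repeat n (x : qmap (Delta n.+1) G) p :
  repeat_at x p -> degeneracy p (fc p.+1 x) = x.
Proof.
move=> [lt_p xp]; apply: simplex_ext => k le_k.
rewrite vtx_degeneracy ?vtx_face; rewrite ?/bump ?/unbump; try lia.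
have [->|ne] := eqVneq k p.+1; last by congr vtx; lia.
by rewrite -xp; congr vtx; lia.
Qed.

End SimplexVertices.

(** * The homotopy on degenerate simplices *)

(** Here [b] and [a] stand for the terms of [d h x] and [h d x], with [p] the first repetition; all
    terms cancel in pairs except [b p.+2]. *)
Lemma alternating_cancel (V : zmodType) (b a : nat -> V) (c : V) (N p : nat) :
  (p.+1 < N)%N ->
  (forall i, (i < p)%N -> b i = - a i) -> b p = - b p.+1 -> b p.+2 = c ->
  a p = - a p.+1 ->
  (forall i, (p.+1 < i < N)%N -> b i.+1 = - a i) ->
  \sum_(i < N.+1) b i + \sum_(i < N) a i = c.
Proof.
move=> lt_pN blt bp bc ap bgt.
rewrite -!(big_mkord xpredT) (big_cat_nat (n := p)) //=; try lia.
rewrite [X in _ + _ + X](big_cat_nat (n := p)) //=; try lia.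
rewrite [\sum_(p <= i < N.+1) _]big_ltn; last by lia.
rewrite [\sum_(p.+1 <= i < N.+1) _]big_ltn; last by lia.
rewrite [\sum_(p.+2 <= i < N.+1) _]big_ltn; last by lia.
rewrite [\sum_(p <= i < N) _]big_ltn; last by lia.
rewrite [\sum_(p.+1 <= i < N) _]big_ltn; last by lia.
rewrite big_add1 /= bp bc ap !addKr.
have -> : \sum_(0 <= i < p) b i = - \sum_(0 <= i < p) a i.
  by rewrite -sumrN !big_nat; apply: eq_bigr => i /andP[_ /blt].
have -> : \sum_(p.+2 <= i < N) b i.+1 = - \sum_(p.+2 <= i < N) a i.
  by rewrite -sumrN !big_nat; apply: eq_bigr => i /bgt.
by rewrite addrACA addNr add0r addrNK.
Qed.

Section DegenerateHomotopy.
Variables (R : comPzRingType) (G : digraph).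
Local Notation M := (singular_maps G).
Local Notation d := differential.

(* At most one [p] satisfies the condition. *)
Definition homotopy n : chain R M n -> chain R M n.+1 :=
  free_extend (fun x : M n => \sum_(p < n.+1 | `[<first_repeat x p>])
    (-1) ^+ p *: free_gen R (degeneracy p x : M n.+1)).
HB.instance Definition _ n := GRing.isLinear.Build R (chain R M n)
  (chain R M n.+1) *:%R (@homotopy n) (free_extend_linear _).

Lemma homotopy_first n (x : M n) p : first_repeat x p ->
  homotopy (free_gen R x : chain R M n) =
  (-1) ^+ p *: free_gen R (degeneracy p x : M n.+1).
Proof.
move=> fp; rewrite /homotopy free_extend_gen.
have lt_p : (p < n.+1)%N by case: fp => -[/ltnW].
rewrite (big_pred1 (Ordinal lt_p)) //= => q.
apply/asboolP/eqP => [fq|->//]; exact/val_inj/(first_repeat_uniq fq fp).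
Qed.

Lemma homotopy_hom n (x : M n) : homomorphism x ->
  homotopy (free_gen R x : chain R M n) = 0.
Proof.
move=> hx; rewrite /homotopy free_extend_gen big_pred0 // => p.
apply/negbTE/negP => /asboolP [rp _].
by apply: (hom_not_degenerate hx); apply/degenerateP; exists p.
Qed.

Hypothesis G_no_double_edge : ~ has_double_edge G.

Lemma homotopy_degenerate n (x : M n.+1) : ~ homomorphism x ->
  d (homotopy (free_gen R x : chain R M n.+1)) +
  homotopy (d (free_gen R x : chain R M n.+1)) = free_gen R x.
Proof.
move=> nhx; have [p fp] : exists p, first_repeat x p.
  have [q rq] : exists q, repeat_at x q.
    apply/degenerateP; apply: contrapT => ndx.
    exact/nhx/not_degenerate_hom.
  exact: repeat_first rq.
have [[lt_p _] _] := fp.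
rewrite (homotopy_first fp). 
have dZ (c : R) (z : chain R M n.+2) : d (c *: z) = c *: d z.
  exact: linearZ_LR.
rewrite dZ !differential_gen.
rewrite scaler_sumr.
rewrite [X in _ + X]linear_sum.
under eq_bigr => i _ do rewrite -[i in face i _]inord_val.
under [X in _ + X]eq_bigr => i _ do rewrite linearZ_LR -[i in face i _]inord_val.
pose b i : chain R M n.+1 := (-1) ^+ p *: ((-1) ^+ i *:
  free_gen R (face (s := M) (inord i) (degeneracy p x) : M n.+1)).
pose a i : chain R M n.+1 :=
  (-1) ^+ i *: homotopy (free_gen R (face (s := M) (inord i) x) : chain R M n).
apply: (alternating_cancel (p := p) (b := b) (a := a)); rewrite /b /a.
- by [].
(* [d_i x] first repeats at [p.-1], so [h] contributes [(-1)^(p-1)], opposite to [(-1)^p]. *)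
- move=> i lt_i; have fpi := first_repeat_face_lt G_no_double_edge fp lt_i.
  rewrite (homotopy_first fpi).
  have ip : (i < p <= n.+1)%N by rewrite lt_i ltnW.
  rewrite (face_degeneracy_lt x ip).
  rewrite !scalerA -scaleNr; congr (_ *: _).
  by case: (p) lt_i => // q _; rewrite exprS mulN1r mulNr mulrC.
- have lt_p' := ltnW lt_p.
  rewrite !face_degeneracy_id ?leqnn ?leqnSn //.
  by rewrite exprS mulN1r scaleNr scalerN opprK.
(* The surviving term: [d_{p+2} s_p x = s_p d_{p+1} x = x], with sign [(-1)^(p + p + 2) = 1]. *)
- have ip : (p < p.+1 <= n.+1)%N by rewrite ltnSn.
  rewrite (face_degeneracy_gt x ip) (degeneracy_face_repeat (proj1 fp)).
  rewrite scalerA -exprD !addnS !exprS !mulN1r opprK addnn -mul2n exprM.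
  by rewrite sqrrN !expr1n scale1r.
- by rewrite (face_repeat (proj1 fp)) exprS mulN1r scaleNr opprK.
(* [d_i x] still first repeats at [p]; the opposite sign comes from the face index [i.+1] in
   [d h x]. *)
- move=> i lt_i; rewrite (homotopy_first (first_repeat_face_gt fp lt_i)).
  have ip : (p < i <= n.+1)%N by lia.
  rewrite (face_degeneracy_gt x ip).
  by rewrite !scalerA -scaleNr exprS mulN1r mulrN mulrC.
Qed.

End DegenerateHomotopy.

Theorem proposition3p2 (R : comPzRingType) (G : digraph) (n : nat)
    (G_no_double_edge : ~ has_double_edge G) :
  (~` @degenerate G n = @homomorphism (Delta n) G /\
   @homomorphism (Delta n) G = @inclusion (Delta n) G) /\
  (lmod_iso (homology R (singular_inclusions G) n)
            (homology R (singular_homs G) n) /\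
   lmod_iso (homology R (singular_homs G) n)
            (homology R (singular_maps G) n)).
Proof.
have hom_incl m : @homomorphism (Delta m) G = @inclusion (Delta m) G.
  by apply/seteqP; split=> [x|x []//]; exact: hom_inclusion.
split; [split=> //|split].
- apply/seteqP; split=> x; first exact: not_degenerate_hom.
  exact: hom_not_degenerate.
- have -> : singular_inclusions G = singular_homs G.
    by apply: eq_sub_semisimplicial => m; rewrite hom_incl.
  exact: lmod_iso_refl.
apply: (@sub_homology_iso R _ _ _ (fun m => @homotopy R G m)).
(* A 0-simplex has no adjacent pair of vertices to repeat. *)
- move=> x; apply: not_degenerate_hom => // /degenerateP [p []].
  by rewrite ltn0.
- by move=> m x; exact: homotopy_hom.
- by move=> m x; exact: homotopy_degenerate.
Qed.
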